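(* Fix $t_0>0$ and $c\ge 0$. Let $(\ell_n)$ be a sequence of min histories on $[t_0,\infty)$ with associated traces $A_n$ satisfying $\sup_n \bar A_n(q)<\infty$ for every $q\in(c,\infty)$, where $\bar A_n(q)=\int_0^\infty e^{-q\tau}A_n(d\tau)$. Then there is a min history $\ell$ such that $\ell_n(t)\to\ell(t)$ as $n\to\infty$ at all points of continuity $t$ of $\ell$ if and only if there is a trace $A$ associated to $\ell$ such that $\bar A_n(q)\to\bar A(q)$ as $n\to\infty$ for all $q\in(c,\infty)$.
   Context: A distribution function on an interval is a right-continuous nondecreasing real function, identified with the measure $A((x_1,x_2])=A(x_2)-A(x_1)$. A min history on $[t_0,\infty)$ is a positive distribution function $\ell$ on $[t_0,\infty)$ with $\ell(t)\to\infty$ as $t\to\infty$; its associated trace is $A(\tau)=\log\ell^\dagger(\tau)$ for $\tau>0$, where $\ell^\dagger(\tau)=\inf\{t\ge t_0:\ell(t)>\tau\}$. A trace is a distribution function $A$ on $(0,\infty)$ such that $A(\tau)=\log t_0$ on some nonempty maximal interval $(0,\tau_0)$ and $A(\tau)\to\infty$ as $\tau\to\infty$; its associated min history is $\ell(t)=\inf\{\tau>0:e^{A(\tau)}>t\}$.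
   Formalization: Convergence of the min histories is considered only at points of continuity t > t_0; the endpoint t_0 is excluded, because convergence of the transforms does not force ℓ_n(t_0) → ℓ(t_0). *)

(* Defs.v *)
From HB Require Import structures.
From mathcomp Require Import all_boot all_order all_algebra.
From mathcomp Require Import all_classical all_reals all_analysis.
Set Implicit Arguments.
Unset Strict Implicit.
Unset Printing Implicit Defensive.
Import Order.TTheory GRing.Theory Num.Theory.
Import numFieldNormedType.Exports.
Local Open Scope classical_set_scope.
Local Open Scope ring_scope.

Section Defs.
Variable R : realType.

Definition min_history (t0 : R) (l : R -> R) : Prop :=
  [/\ (forall s t, t0 <= s -> s <= t -> l s <= l t),
      (forall t, t0 <= t -> l x @[x --> t^'+] --> l t),
      (forall t, t0 <= t -> 0 < l t) &
      (l x @[x --> +oo] --> +oo)].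

Definition ldagger (t0 : R) (l : R -> R) (tau : R) : R :=
  inf [set t | t0 <= t /\ tau < l t].

(** The trace associated to l: A(tau) = log l^dagger(tau).  (Used on tau > 0;
    for tau <= 0 the same formula gives the constant log t0.) *)
Definition trace_of (t0 : R) (l : R -> R) (tau : R) : R :=
  ln (ldagger t0 l tau).

Definition is_cumulative (A : R -> R) : Prop :=
  {homo A : x y / x <= y} /\ (forall x, A y @[y --> x^'+] --> A x).

Definition LS_measure (A : R -> R) (h : is_cumulative A) :=
  lebesgue_stieltjes_measure
    (HB.pack A (isCumulative.Build R _ R A (proj1 h) (proj2 h))).

Definition laplace_stieltjes (A : R -> R) (q : R) : \bar R :=
  match pselect (is_cumulative A) with
  | left h => (\int[LS_measure h]_(x in `]0%R, +oo[) (expR (- (q * x)))%:E)%E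
  | right _ => +oo%E
  end.

End Defs.

(* Main.v *)
(** In logarithmic time [u = log (t / t0)], the measure [A(d tau)] is the image of
    Lebesgue measure on [[0, +oo[] under [k u = l (t0 * e ^ u)], so its transform is
    [\int_0^oo e ^ (- q k(u)) du].  If the histories converge, the tails of these
    integrals are uniformly small, by comparison with a smaller exponent in
    [(c, q)], and dominated convergence applies on bounded segments, a monotone
    function having only countably many discontinuities.  Conversely, convergence
    of the transforms yields that of [\int phi (k_n u) du] for
    [phi x = 1 - (1 - e ^ (- p x)) ^ N], a combination of exponentials with
    exponents multiples of [p > c].  For suitable [p] and [N], [phi] is close to 1 on
    [[0, s]] and dominated by [eps * e ^ (- q x)] beyond [s' > s], so these integrals
    nearly measure [{u | k_n u <= s}], which forces the convergence of [k_n] at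
    every point of continuity of [k]. *)
Require Import Defs.
From HB Require Import structures.
From mathcomp Require Import all_boot all_order all_algebra.
From mathcomp Require Import all_classical all_reals all_analysis.
From mathcomp Require Import measurable_realfun ring lra.
Import Order.TTheory GRing.Theory Num.Theory.
Import numFieldNormedType.Exports.
Local Open Scope classical_set_scope.
Local Open Scope ring_scope.

Set Implicit Arguments.
Unset Strict Implicit.
Unset Printing Implicit Defensive.

(* The [max] extends the history constantly to [u < 0], which makes it monotone,
   hence measurable, on the whole line. *)
Definition log_history (R : realType) (t0 : R) (l : R -> R) (u : R) : R :=
  l (t0 * expR (Num.max u 0)).

Lemma ler_log_time (R : realType) (t0 u : R) :
  0 < t0 -> t0 <= t0 * expR (Num.max u 0).
Proof.
move=> t0_gt0; apply: ler_peMr; first exact: ltW.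
by rewrite -expR0 ler_expR le_max lexx orbT.
Qed.

Lemma nondecreasing_log_history (R : realType) (t0 : R) (l : R -> R) :
  0 < t0 -> min_history t0 l -> nondecreasing_fun (log_history t0 l).
Proof.
move=> t0_gt0 [l_nd _ _ _] u v uv; apply: l_nd; first exact: ler_log_time.
by rewrite ler_pM2l// ler_expR ge_max !le_max uv lexx orbT.
Qed.

Lemma log_history_gt0 (R : realType) (t0 : R) (l : R -> R) (u : R) :
  0 < t0 -> min_history t0 l -> 0 < log_history t0 l u.
Proof. by move=> t0_gt0 [_ _ l_gt0 _]; exact/l_gt0/ler_log_time. Qed.

(** * The generalized inverse and the trace *)

(** Divergence of [l] keeps the infimum away from its default value 0 on the empty set. *)
Lemma ldagger_set_nonempty (R : realType) (t0 tau : R) (l : R -> R) :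
  min_history t0 l -> [set t | t0 <= t /\ tau < l t] !=set0.
Proof.
move=> [_ _ _ /cvgryPgt/(_ tau) [M [_ HM]]].
exists (Num.max t0 (M + 1)); split; first by rewrite le_max lexx.
by apply: HM; rewrite lt_max ltrDl ltr01 orbT.
Qed.

Lemma ldagger_le (R : realType) (t0 tau t : R) (l : R -> R) :
  t0 <= t -> tau < l t -> ldagger t0 l tau <= t.
Proof.
move=> t0t taut; apply: ge_inf; last by split.
by exists t0 => y [].
Qed.

Lemma ldagger_ge (R : realType) (t0 tau : R) (l : R -> R) :
  min_history t0 l -> t0 <= ldagger t0 l tau.
Proof.
by move=> hl; apply: lb_le_inf => [|y []//]; exact: ldagger_set_nonempty.
Qed.

Lemma ldagger_lt_ex (R : realType) (t0 tau v : R) (l : R -> R) :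
  min_history t0 l -> ldagger t0 l tau < v ->
  exists t, [/\ t0 <= t, t < v & tau < l t].
Proof.
by move=> hl /(inf_lt (ldagger_set_nonempty tau hl))[t /= [t0t taut] tv]; exists t.
Qed.

Lemma ldagger_nondecreasing (R : realType) (t0 : R) (l : R -> R) :
  min_history t0 l -> {homo ldagger t0 l : x y / x <= y}.
Proof.
move=> hl x y xy; apply: lb_le_inf; first exact: ldagger_set_nonempty.
by move=> t [t0t yt]; apply: ldagger_le => //; exact: le_lt_trans yt.
Qed.

Lemma trace_is_cumulative (R : realType) (t0 : R) (l : R -> R) :
  0 < t0 -> min_history t0 l -> is_cumulative (trace_of t0 l).
Proof.
move=> t0_gt0 hl; have T_gt0 x : 0 < ldagger t0 l x.
  exact: lt_le_trans (ldagger_ge x hl).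
split=> [x y xy|x]; first by rewrite /trace_of ler_ln ?posrE// ldagger_nondecreasing.
apply: (@cvg_comp _ _ _ (ldagger t0 l) (@ln R) _ (nbhs (ldagger t0 l x))); last first.
  exact: continuous_ln.
apply/cvgrPdist_lt => e e0.
(* One [t] serves every [y] slightly above [x], since [y < l t] persists there: this is right
   continuity. *)
have /(ldagger_lt_ex hl)[t [t0t te xt]] : ldagger t0 l x < ldagger t0 l x + e.
  by rewrite ltrDl.
near=> y; rewrite distrC ger0_norm; last first.
  by rewrite subr_ge0; apply: ldagger_nondecreasing.
by rewrite ltrBlDl; apply: le_lt_trans te; apply: ldagger_le => //.
Unshelve. all: by end_near. Qed.

(** Together with [lt_log_history_le], this inverts the trace up to the single point
    [u = trace_of t0 l tau - ln t0], where either comparison may hold. A point has length 0, so this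
    suffices for measures. *)
Lemma lt_log_history (R : realType) (t0 tau u : R) (l : R -> R) :
  0 < t0 -> min_history t0 l -> 0 <= u ->
  trace_of t0 l tau - ln t0 < u -> tau < log_history t0 l u.
Proof.
move=> t0_gt0 hl u0; rewrite ltrBlDl => Au.
have /(ldagger_lt_ex hl)[t [t0t tu taut]] : ldagger t0 l tau < t0 * expR u.
  rewrite -ltr_ln ?posrE ?mulr_gt0 ?expR_gt0//.
    by rewrite lnM ?posrE ?expR_gt0// expRK.
  exact: lt_le_trans (ldagger_ge tau hl).
case: hl => l_nd _ _ _; apply: lt_le_trans taut _.
by rewrite /log_history (max_idPl u0) l_nd// ltW.
Qed.

Lemma lt_log_history_le (R : realType) (t0 tau u : R) (l : R -> R) :
  0 < t0 -> min_history t0 l -> 0 <= u ->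
  tau < log_history t0 l u -> trace_of t0 l tau - ln t0 <= u.
Proof.
move=> t0_gt0 hl u0 tauu; rewrite lerBlDl -[u in leRHS]expRK -lnM ?posrE ?expR_gt0//.
rewrite ler_ln ?posrE ?mulr_gt0 ?expR_gt0//; last first.
  exact: lt_le_trans (ldagger_ge tau hl).
have := ler_log_time u t0_gt0.
move: tauu; rewrite /log_history (max_idPl u0) => tauu t0u.
exact: ldagger_le.
Qed.

(** * The transform as an integral in logarithmic time *)

Notation log_laplace k q :=
  (\int[lebesgue_measure]_(u in `[0%R, +oo[) (expR (- (q * k u)))%:E)%E.

(** The Stieltjes measure of the trace and the image of Lebesgue measure agree on half-open
    intervals, hence on all measurable sets; a change of variables concludes. *)
Lemma laplace_stieltjes_trace (R : realType) (t0 q : R) (l : R -> R) :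
  0 < t0 -> min_history t0 l ->
  laplace_stieltjes (trace_of t0 l) q = log_laplace (log_history t0 l) q.
Proof.
move=> t0_gt0 hl; rewrite /laplace_stieltjes.
case: pselect => [hA|]; last by case; exact: trace_is_cumulative.
set k : measurableTypeR R -> measurableTypeR R := log_history t0 l.
set D : set R := `[0, +oo[%classic.
have mD : measurable D by exact: measurable_itv.
have k_nd : nondecreasing_fun k by exact: nondecreasing_log_history.
have mk : measurable_fun setT k by exact: nondecreasing_measurable.
have mf : measurable_fun setT (fun x : R => (expR (- (q * x)))%:E).
  apply/measurable_EFinP; apply: measurableT_comp => //.
  by apply: measurableT_comp => //; exact: measurable_funM.
(* Restricting to [D] discards the artificial values of [k] at negative times. *)
pose m : {measure set (measurableTypeR R) -> \bar R} := mrestr lebesgue_measure mD.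
have [nu nuE] : exists nu : {measure set (measurableTypeR R) -> \bar R},
    nu = pushforward m k :> (set R -> \bar R).
  unshelve eexists.
    unshelve refine (pushforward m k : {measure set (measurableTypeR R) -> \bar R}).
    exact: mk.
  by [].
transitivity (\int[nu]_(x in `]0%R, +oo[) (expR (- (q * x)))%:E)%E.
  apply: eq_measure_integral => X mX _.
  apply: lebesgue_stieltjes_measure_unique => // I [[a b]]/= _ <-.
  rewrite nuE.
  rewrite [LHS]/lebesgue_stieltjes_measure [LHS]/measure_extension.
  rewrite measurable_mu_extE; last exact: is_ocitv.
  have [ab|ba] := leP a b; last first.
    by rewrite set_itv_ge ?wlength0 ?measure0// bnd_simp -leNgt ltW.
  transitivity (trace_of t0 l b - trace_of t0 l a)%:E; first exact: wlength_itv_bnd.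
  rewrite /pushforward /m /= /mrestr.
  set S := k @^-1` _ `&` D.
  (* The preimage [S] is squeezed between []al, be[] and [[al, be]], which have the same length. *)
  pose al := trace_of t0 l a - ln t0; pose be := trace_of t0 l b - ln t0.
  have al0 : 0 <= al.
    have := ldagger_ge a hl; rewrite subr_ge0 => t0a.
    by rewrite ler_ln ?posrE// (lt_le_trans t0_gt0).
  have albe : al <= be by rewrite lerB//; apply: (proj1 hA).
  have Scc : S `<=` `[al, be].
    move=> u [/=]; rewrite in_itv/= => /andP[au ub].
    rewrite /D /= in_itv/= andbT => u0; rewrite in_itv/=.
    rewrite (lt_log_history_le t0_gt0 hl)//= leNgt; apply/negP => bu.
    by move: ub; rewrite leNgt (lt_log_history t0_gt0 hl).
  have ooS : `]al, be[ `<=` S.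
    move=> u /=; rewrite in_itv/= => /andP[au ub].
    have u0 : 0 <= u by rewrite ltW// (le_lt_trans al0).
    split; last by rewrite /D /= in_itv/= u0.
    rewrite /= in_itv/= (lt_log_history t0_gt0 hl)//= leNgt.
    by apply/negP => /(lt_log_history_le t0_gt0 hl u0); rewrite leNgt ub.
  have mS : measurable S.
    apply: measurableI => //.
    by rewrite -[X in measurable X]setTI; exact: mk.
  have mcc : lebesgue_measure `[al, be] = (trace_of t0 l b - trace_of t0 l a)%:E.
    rewrite lebesgue_measure_itv/= lte_fin; case: ltP => [_|].
      by rewrite -EFinD; congr EFin; rewrite /al /be; ring.
    by move=> beal; congr EFin; move: albe beal; rewrite /al /be; lra.
  have moo : lebesgue_measure `]al, be[ = (trace_of t0 l b - trace_of t0 l a)%:E.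
    by rewrite -mcc !lebesgue_measure_itv.
  apply/eqP; rewrite eq_le; apply/andP; split.
    by rewrite -moo; apply: le_measure => //; rewrite inE.
  by rewrite -mcc; apply: le_measure => //; rewrite inE.
rewrite nuE ge0_integral_pushforward//; last exact: measurable_funTS.
have -> : k @^-1` `]0, +oo[%classic = setT.
  by apply/seteqP; split=> // u _ /=; rewrite in_itv/= andbT log_history_gt0.
rewrite (@ge0_negligible_integral _ _ _ m _ (~` D)) ?setTD ?setCK//.
- apply: eq_measure_integral => X _ XD.
  by rewrite /m /= /mrestr setIidl.
- exact: measurableC.
- exact: measurableT_comp.
- by move=> u _; rewrite lee_fin expR_ge0.
- by rewrite /m /= /mrestr setICl measure0.
Qed.

(** * Continuity points of monotone functions *)

(** [discontinuity_countable] counts jumps, where the one-sided limits exist and differ. For a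
    monotone [k] these limits exist and enclose [k u], so their equality means continuity. *)
Lemma countable_not_continuous (R : realType) (k : R -> R) (a b : R) :
  nondecreasing_fun k ->
  countable [set u | u \in (`]a, b[) /\ ~ {for u, continuous k}].
Proof.
move=> k_nd; apply: (sub_countable _ (@discontinuity_countable R a b k _)); last first.
  by move=> x y _ _; exact: k_nd.
apply: subset_card_le => u [uab ncont]; split; first by rewrite inE.
have cl : cvg (k x @[x --> u^'-]).
  apply: nondecreasing_at_left_is_cvgr.
    by near=> x => y z _ _; exact: k_nd.
  near=> x; exists (k u) => _ /= [y + <-].
  by rewrite in_itv/= => /andP[_ /ltW]; exact: k_nd.
have cr : cvg (k x @[x --> u^'+]).
  apply: nondecreasing_at_right_is_cvgr.
    by near=> x => y z _ _; exact: k_nd.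
  near=> x; exists (k u) => _ /= [y + <-].
  by rewrite in_itv/= => /andP[/ltW + _]; exact: k_nd.
split=> //; apply/eqP => lr; apply: ncont.
have lu : lim (k x @[x --> u^'-]) <= k u.
  apply: limr_le => //; near=> x; apply: k_nd; apply: ltW; near: x.
  exact: nbhs_left_lt.
have ru : k u <= lim (k x @[x --> u^'+]).
  apply: limr_ge => //; near=> x; apply: k_nd; apply: ltW; near: x.
  exact: nbhs_right_gt.
have lE : lim (k x @[x --> u^'-]) = k u by apply/eqP; rewrite eq_le lu lr ru.
have rE : lim (k x @[x --> u^'+]) = k u by rewrite -lr.
by apply/left_right_continuousP; split; [rewrite -lE|rewrite -rE].
Unshelve. all: by end_near. Qed.

(** Otherwise the null set of discontinuities would fill an interval of positive length. *)
Lemma exists_continuous (R : realType) (k : R -> R) (a b : R) :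
  nondecreasing_fun k -> a < b ->
  exists u, [/\ a < u, u < b & {for u, continuous k}].
Proof.
move=> k_nd ab; apply: contrapT => nex.
have := countable_lebesgue_measure0 (countable_not_continuous a b k_nd).
suff -> : [set u | u \in (`]a, b[) /\ ~ {for u, continuous k}] = `]a, b[%classic.
  rewrite lebesgue_measure_itv/= lte_fin ab -EFinD => /eqP.
  by rewrite eqe subr_eq0 gt_eqF.
apply/seteqP; split=> u; first by case.
move=> /= uab; split=> // cu; apply: nex; exists u; split=> //.
- by move: uab; rewrite in_itv => /andP[].
- by move: uab; rewrite in_itv => /andP[].
Qed.

(** * From convergence of histories to convergence of transforms *)

Lemma measurable_expR_neg (R : realType) (k : R -> R) (q : R) (D : set R) :
  nondecreasing_fun k -> measurable D ->
  measurable_fun D (fun u => expR (- (q * k u))).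
Proof.
move=> k_nd mD; apply: measurableT_comp => //; apply: measurableT_comp => //.
by apply: measurable_funM => //; exact: nondecreasing_measurable.
Qed.

Lemma integrable_expR_neg (R : realType) (k : R -> R) (q M : R) :
  nondecreasing_fun k -> (log_laplace k q <= M%:E)%E ->
  lebesgue_measure.-integrable `[0, +oo[ (EFin \o (fun u => expR (- (q * k u)))).
Proof.
move=> k_nd kM; apply/integrableP; split.
  by apply/measurable_EFinP; exact: measurable_expR_neg.
apply: le_lt_trans (ltry M); apply: le_trans kM.
by under eq_integral do rewrite /= ger0_norm ?expR_ge0//.
Qed.

Lemma integrable_cst_segment (R : realType) (c U : R) :
  lebesgue_measure.-integrable `[0, U] (EFin \o cst c).
Proof.
have Ufin : (lebesgue_measure (`[0%R, U] : set R) < +oo)%E.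
  by rewrite lebesgue_measure_itv/=; case: ifP => // _; rewrite -EFinD ltry.
apply: (measurable_bounded_integrable (f := cst c) _ Ufin) => //.
exact: bounded_cst.
Qed.

Lemma cvg_integral_segment (R : realType) (q U : R) (ks : nat -> R -> R) (k : R -> R) :
  0 <= q -> (forall n, nondecreasing_fun (ks n)) -> (forall n u, 0 <= ks n u) ->
  nondecreasing_fun k ->
  (forall u, 0 < u -> {for u, continuous k} -> ks n u @[n --> \oo] --> k u) ->
  (\int[lebesgue_measure]_(u in `[0%R, U]) (expR (- (q * ks n u)))%:E)%E
    @[n --> \oo] -->
  (\int[lebesgue_measure]_(u in `[0%R, U]) (expR (- (q * k u)))%:E)%E.
Proof.
move=> q0 ks_nd ks0 k_nd ksk.
have [] := @dominated_convergence _ _ R lebesgue_measure `[0, U]%classic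
  (measurable_itv _) (fun n u => (expR (- (q * ks n u)))%:E)
  (fun u => (expR (- (q * k u)))%:E) (cst 1%E) _ _ _ _ _ => //.
- by move=> n; apply/measurable_EFinP; exact: measurable_expR_neg.
- by apply/measurable_EFinP; exact: measurable_expR_neg.
(* The point 0 is set aside because convergence is assumed only for [u > 0]; the open interval
   overshoots so as to contain [U]. *)
- exists ([set 0] `|` [set u | u \in (`](-1), (U + 1)[) /\ ~ {for u, continuous k}]).
  have cN := countable_not_continuous (-1) (U + 1) k_nd.
  split.
  + by apply: measurableU => //; exact: countable_measurable.
  + apply: null_set_setU => //; first exact: countable_measurable.
      exact/countable_lebesgue_measure0/countable1.
    exact: countable_lebesgue_measure0.
  + move=> u /= /not_implyP[]; rewrite in_itv/= => /andP[u0 uU] ncvg.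
    have [->|une0] := eqVneq u 0; first by left.
    right; split; first by rewrite in_itv/=; apply/andP; split; lra.
    move=> cu; apply: ncvg; apply: cvg_EFin; first exact: nearW.
    have /ksk /(_ cu) {}ksk : 0 < u by rewrite lt_neqAle eq_sym une0.
    have : expR (- (q * ks n u)) @[n --> \oo] --> expR (- (q * k u)).
      apply: continuous_cvg; first exact: continuous_expR.
      by apply: cvgN; exact: cvgMl_tmp.
    exact.
- exact: integrable_cst_segment.
- apply: aeW => u n _ /=; rewrite lee_fin ger0_norm ?expR_ge0//.
  by rewrite -expR0 ler_expR oppr_le0 mulr_ge0.
Qed.

(** By monotone convergence. This carries a uniform bound over to the limit history, where at first
    only segments can be controlled. *)
Lemma log_laplace_le_segment (R : realType) (q M : R) (k : R -> R) :
  nondecreasing_fun k ->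
  (forall U : R, (\int[lebesgue_measure]_(u in `[0%R, U]) (expR (- (q * k u)))%:E <= M%:E)%E) ->
  (log_laplace k q <= M%:E)%E.
Proof.
move=> k_nd kM.
have -> : `[0%R, +oo[%classic = \bigcup_i `[0%R, i%:R : R]%classic.
  by rewrite (itv_bndy_bigcup_BRight true 0); under eq_bigcupr do rewrite add0r.
apply: (cvge_to_le (ge0_nondecreasing_set_cvg_integral _ _ _ _)) => //.
- move=> i j ij; rewrite subsetEset; apply: subset_itvl.
  by rewrite bnd_simp ler_nat.
- by move=> i; apply/measurable_EFinP; exact: measurable_expR_neg.
- by near=> i.
Unshelve. all: by end_near. Qed.

Lemma log_laplace_le (R : realType) (q p M : R) (k : R -> R) :
  nondecreasing_fun k -> (forall u, 0 <= k u) -> q <= p ->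
  (log_laplace k q <= M%:E)%E -> (log_laplace k p <= M%:E)%E.
Proof.
move=> k_nd k0 qp; apply: le_trans; apply: ge0_le_integral => //.
- by apply/measurable_EFinP; exact: measurable_expR_neg.
- by apply/measurable_EFinP; exact: measurable_expR_neg.
- by move=> u _; rewrite lee_fin ler_expR lerN2 ler_wpM2r.
Qed.

(** Past [U] one has [k u >= T], so [e ^ (- p k)] is at most [e ^ (- (p - q) T) e ^ (- q k)]. The
    bound depends on [k] only through [M] and [T], hence is uniform along a sequence. *)
Lemma log_laplace_tail (R : realType) (q p M U T : R) (k : R -> R) :
  nondecreasing_fun k -> (forall u, 0 <= k u) -> q <= p -> 0 <= U -> T <= k U ->
  (log_laplace k q <= M%:E)%E ->
  `|fine (log_laplace k p) -
    fine (\int[lebesgue_measure]_(u in `[0%R, U]) (expR (- (p * k u)))%:E)%E| <=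
  expR (- ((p - q) * T)) * M.
Proof.
move=> k_nd k0 qp U0 TU kM.
have kMp := log_laplace_le k_nd k0 qp kM.
have iq := integrable_expR_neg k_nd kM.
have ip := integrable_expR_neg k_nd kMp.
have sub : `]U, +oo[%classic `<=` `[0%R, +oo[%classic.
  by move=> u /=; rewrite !in_itv/= !andbT => /ltW; exact: le_trans.
have iqU : lebesgue_measure.-integrable `]U, +oo[ (EFin \o (fun u => expR (- (q * k u)))).
  exact: integrableS iq.
have ipU : lebesgue_measure.-integrable `]U, +oo[ (EFin \o (fun u => expR (- (p * k u)))).
  exact: integrableS ip.
have := Rintegral_itvB ip; rewrite /Rintegral => -> //.
rewrite ger0_norm; last by apply: Rintegral_ge0 => u _; exact: expR_ge0.
apply: (@le_trans _ _ (\int[lebesgue_measure]_(u in `]U, +oo[)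
    (expR (- ((p - q) * T)) * expR (- (q * k u))))).
  apply: le_Rintegral => //.
    by move: iqU => /(@integrableZl _ _ _ _ _ _ (expR (- ((p - q) * T)))); exact.
  move=> u /=; rewrite in_itv/= andbT => Uu; rewrite -expRD ler_expR.
  have : T <= k u by apply: (le_trans TU); apply: k_nd; exact: ltW.
  move=> Tk; rewrite -opprD lerN2.
  have : 0 <= (p - q) * (k u - T) by rewrite mulr_ge0 ?subr_ge0.
  by lra.
rewrite RintegralZl// ler_wpM2l ?expR_ge0// -lee_fin fineK; last first.
  exact: integrable_fin_num.
apply: le_trans kM; apply: ge0_subset_integral => //.
by apply/measurable_EFinP; exact: measurable_expR_neg.
Qed.

Lemma ltr_dist3 (R : realFieldType) (a b c d e : R) :
  `|a - b| < e / 3 -> `|b - c| < e / 3 -> `|d - c| < e / 3 -> `|a - d| < e.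
Proof.
by rewrite !ltr_norml => /andP[? ?] /andP[? ?] /andP[? ?]; apply/andP; split; lra.
Qed.

Lemma cvg_log_laplace (R : realType) (q p M : R) (ks : nat -> R -> R) (k : R -> R) :
  0 <= q -> q < p -> (forall n, nondecreasing_fun (ks n)) -> (forall n u, 0 <= ks n u) ->
  nondecreasing_fun k -> (forall u, 0 <= k u) -> k u @[u --> +oo] --> +oo ->
  (forall n, (log_laplace (ks n) q <= M%:E)%E) ->
  (forall u, 0 < u -> {for u, continuous k} -> ks n u @[n --> \oo] --> k u) ->
  log_laplace (ks n) p @[n --> \oo] --> log_laplace k p.
Proof.
move=> q0 qp ks_nd ks0 k_nd k0 ky ksM ksk.
have kM : (log_laplace k q <= M%:E)%E.
  apply: log_laplace_le_segment => // U.
  apply: (cvge_to_le (cvg_integral_segment q0 ks_nd ks0 k_nd ksk)).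
  near=> n; apply: le_trans (ksM n); apply: ge0_subset_integral => //.
    by apply/measurable_EFinP; exact: measurable_expR_neg.
  by apply: subset_itvl.
have M0 : 0 <= M by rewrite -lee_fin; apply: le_trans kM; exact: integral_ge0.
have fn : forall f, nondecreasing_fun f -> (forall u, 0 <= f u) ->
    (log_laplace f q <= M%:E)%E -> log_laplace f p \is a fin_num.
  move=> f f_nd f0 fM; apply: integrable_fin_num => //.
  exact: (integrable_expR_neg f_nd (log_laplace_le f_nd f0 (ltW qp) fM)).
rewrite -(fineK (fn _ k_nd k0 kM)); apply: cvg_EFin.
  by apply: nearW => n; exact: fn.
apply/cvgrPdist_lt => e e0.
(* [T] makes [(p - q) T] equal to [x = M / (e / 3)], and [x < 1 + x <= e ^ x]. *)
have [T MT] : exists T, expR (- ((p - q) * T)) * M < e / 3.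
  exists ((p - q)^-1 * (M / (e / 3))).
  rewrite mulrA divff ?mul1r; last by rewrite subr_eq0 gt_eqF.
  have := expR_ge1Dx (M / (e / 3)); set x := M / _ => ex.
  have e30 : 0 < e / 3 by rewrite divr_gt0.
  rewrite expRN mulrC ltr_pdivrMr ?expR_gt0// -ltr_pdivrMl// mulrC.
  by apply: lt_le_trans ex; rewrite -/x ltrDr.
(* The spare 1, with convergence at the continuity point [U], gives [ks n U >= T] for large [n]: one
   cut serves all tails. *)
have /cvgryPge/(_ (T + 1))[V [_ kV]] := ky.
have [U [VU _ cU]] : exists U, [/\ Num.max V 0 < U, U < Num.max V 0 + 1 & {for U, continuous k}].
  by apply: exists_continuous => //; rewrite ltrDl.
move: VU; rewrite gt_max => /andP[/kV kU U0].
have p0 : 0 <= p by rewrite (le_trans q0)// ltW.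
have := @cvg_integral_segment _ p U ks k p0 ks_nd ks0 k_nd ksk.
have fS f : nondecreasing_fun f -> (forall u, 0 <= f u) -> (log_laplace f q <= M%:E)%E ->
   (\int[lebesgue_measure]_(u in `[0%R, U]) (expR (- (p * f u)))%:E)%E \is a fin_num.
  move=> f_nd f0 fM; apply: integrable_fin_num => //.
  have := @integrable_expR_neg _ f p M f_nd (log_laplace_le f_nd f0 (ltW qp) fM).
  apply: integrableS => //.
  by apply: subset_itvl.
rewrite -(fineK (fS _ k_nd k0 kM)) => /fine_cvg/cvgrPdist_lt/(_ (e / 3)) cS.
have e30 : 0 < e / 3 by rewrite divr_gt0.
have kTU : T <= k U by apply: le_trans kU; rewrite lerDl.
near=> n.
have ksTU : T <= ks n U.
  near: n; have /cvgrPdist_lt/(_ 1 ltr01) := ksk U U0 cU.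
  by apply: filterS => n; rewrite ltr_norml => /andP[_]; lra.
have t1 := log_laplace_tail k_nd k0 (ltW qp) (ltW U0) kTU kM.
have t2 := log_laplace_tail (ks_nd n) (ks0 n) (ltW qp) (ltW U0) ksTU (ksM n).
have t3 : `| fine (\int[lebesgue_measure]_(u in `[0%R, U]) (expR (- (p * k u)))%:E)%E -
   fine (\int[lebesgue_measure]_(u in `[0%R, U]) (expR (- (p * ks n u)))%:E)%E | < e / 3.
  by near: n; exact: cS.
exact: ltr_dist3 (le_lt_trans t1 MT) t3 (le_lt_trans t2 MT).
Unshelve. all: by end_near. Qed.

(** * A class of test functions closed under sums and differences *)

Section integrals_converge.
Variables (R : realType) (ks : nat -> R -> R) (k : R -> R).
Local Notation mu := (@lebesgue_measure R).
Local Notation D := (`[0%R, +oo[%classic : set R).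

Let mD : measurable (D : set (measurableTypeR R)).
Proof. exact: measurable_itv. Qed.

(** Integrability is included because the real-valued integral reads an infinite value as 0 and is
    additive only on integrable functions. *)
Definition integrals_converge (phi : R -> R) :=
  [/\ (forall n, mu.-integrable D (EFin \o (fun u => phi (ks n u)))),
      mu.-integrable D (EFin \o (fun u => phi (k u))) &
      \int[mu]_(u in D) phi (ks n u) @[n --> \oo] --> \int[mu]_(u in D) phi (k u)].

Lemma integrals_converge0 : integrals_converge (fun=> 0).
Proof.
by split=> [n||]; [exact: integrable0|exact: integrable0|exact: cvg_cst].
Qed.

Lemma integrals_convergeD phi psi :
  integrals_converge phi -> integrals_converge psi ->
  integrals_converge (fun x => phi x + psi x).
Proof.
move=> [phin phik phic] [psin psik psic].
split.
- by move=> n; move: (integrableD mD (phin n) (psin n)).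
- by move: (integrableD mD phik psik).
rewrite RintegralD//; under eq_cvg do rewrite RintegralD//.
exact: cvgD.
Qed.

Lemma integrals_convergeB phi psi :
  integrals_converge phi -> integrals_converge psi ->
  integrals_converge (fun x => phi x - psi x).
Proof.
move=> [phin phik phic] [psin psik psic].
split.
- by move=> n; move: (integrableB mD (phin n) (psin n)).
- by move: (integrableB mD phik psik).
rewrite RintegralB//; under eq_cvg do rewrite RintegralB//.
exact: cvgB.
Qed.

Lemma integrals_converge_expR (p : R) :
  (forall n, nondecreasing_fun (ks n)) -> nondecreasing_fun k ->
  (exists M, forall n, (log_laplace (ks n) p <= M%:E)%E) ->
  log_laplace (ks n) p @[n --> \oo] --> log_laplace k p ->
  integrals_converge (fun x => expR (- (p * x))).
Proof.
move=> ks_nd k_nd [M ksM] ksk.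
have kM : (log_laplace k p <= M%:E)%E by apply: (cvge_to_le ksk); exact: nearW.
split.
- by move=> n; exact: integrable_expR_neg (ksM n).
- exact: integrable_expR_neg kM.
- apply: fine_cvg; rewrite fineK//; apply: integrable_fin_num => //.
  exact: integrable_expR_neg kM.
Qed.

(** The constant 1 is not integrable on the half-line, so it must never be split off. Raising [N] by
    one adds [e ^ (- p x) (1 - e ^ (- p x)) ^ N], which keeps a decaying factor. *)
Lemma integrals_converge_cutoff (p : R) (N : nat) :
  (forall i, integrals_converge (fun x => expR (- (i.+1%:R * p * x)))) ->
  integrals_converge (fun x => 1 - (1 - expR (- (p * x))) ^+ N).
Proof.
move=> exp_cvg.
(* Stated for every [i], because a further factor [1 - e ^ (- p x)] splits a term into those for [i]
   and [i + 1]. *)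
have psi_cvg M i : integrals_converge
    (fun x => expR (- (i.+1%:R * p * x)) * (1 - expR (- (p * x))) ^+ M).
  elim: M i => [|M IH] i.
    by rewrite [X in integrals_converge X](_ : _ = fun x => expR (- (i.+1%:R * p * x)))//;
      apply/funext => x; rewrite expr0 mulr1.
  rewrite [X in integrals_converge X](_ : _ = fun x =>
      expR (- (i.+1%:R * p * x)) * (1 - expR (- (p * x))) ^+ M -
      expR (- (i.+2%:R * p * x)) * (1 - expR (- (p * x))) ^+ M); last first.
    apply/funext => x; rewrite exprS.
    have -> : - (i.+2%:R * p * x) = - (i.+1%:R * p * x) - p * x.
      by rewrite -(addn1 i.+1) natrD; ring.
    by rewrite expRD; ring.
  by apply: integrals_convergeB; exact: IH.
elim: N => [|N IH].
  rewrite [X in integrals_converge X](_ : _ = fun=> 0); first exact: integrals_converge0.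
  by apply/funext => x; rewrite expr0 subrr.
rewrite [X in integrals_converge X](_ : _ = fun x =>
    1 - (1 - expR (- (p * x))) ^+ N +
    expR (- (1%:R * p * x)) * (1 - expR (- (p * x))) ^+ N); last first.
  by apply/funext => x; rewrite exprS mul1r; ring.
exact: integrals_convergeD.
Qed.

End integrals_converge.

(** * Cutoff functions *)

(** Bernoulli's inequality, which bounds the cutoff beyond the step. *)
Lemma one_subrX_le (R : realFieldType) (x : R) (N : nat) :
  0 <= x -> x <= 1 -> 1 - (1 - x) ^+ N <= N%:R * x.
Proof.
move=> x0 x1; elim: N => [|N IH]; first by rewrite expr0 subrr mul0r.
have : (1 - x) * (1 - N%:R * x) <= (1 - x) * (1 - x) ^+ N.
  by rewrite ler_wpM2l ?subr_ge0//; lra.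
have : 0 <= N%:R * x * x by rewrite !mulr_ge0.
by rewrite exprS -natr1; lra.
Qed.

(* [phi] is a smoothed step: [1 - phi x] is about [exp (- N e ^ (- p x))], which drops
   from 1 to 0 around [x = ln N / p]; hence [N] of order [e ^ (p s) / eps] and [p]
   large. *)
Lemma exists_cutoff (R : realType) (q s s' eps : R) :
  0 <= q -> 0 <= s -> s < s' -> 0 < eps ->
  exists p N, let phi x : R := 1 - (1 - expR (- (p * x))) ^+ N in
    [/\ q <= p, forall x, 0 <= x -> 0 <= phi x /\ phi x <= 1,
        forall x, 0 <= x -> x <= s -> 1 - eps <= phi x &
        forall x, s' <= x -> phi x <= eps * expR (- (q * x))].
Proof.
move=> q0 s0 ss' eps0; have ss'0 : 0 < s' - s by rewrite subr_gt0.
have eps1 : 0 <= eps^-1 + 1 by rewrite addr_ge0// invr_ge0 ltW.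
(* With this [B] and [p], [e ^ (p (s' - s)) >= p (s' - s) >= B], which reduces the prefactor
   [(1 / eps + 1) e ^ (q s')] to at most [eps]. *)
pose B := (eps^-1 + 1) * expR (q * s') / eps.
have B0 : 0 <= B by rewrite divr_ge0 ?mulr_ge0 ?expR_ge0// ltW.
pose p := B / (s' - s) + q.
have p0 : 0 <= p by rewrite addr_ge0// divr_ge0// ltW.
pose y := expR (p * s) / eps.
have y0 : 0 <= y by rewrite divr_ge0 ?expR_ge0 ?ltW.
(* Rounding [y] up gives both [N e ^ (- p s) >= 1 / eps] and [N <= (1 / eps + 1) e ^ (p s)]. *)
have /andP[Ny yN] := truncn_itv y0; set N := (Num.truncn y).+1 in yN.
have expp x : 0 <= x -> expR (- (p * x)) <= 1.
  by move=> x0; rewrite -expR0 ler_expR oppr_le0 mulr_ge0.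
have qp : q <= p by rewrite lerDr divr_ge0// ltW.
exists p, N; split=> //.
- move=> x x0; have := expp x x0; have := expR_ge0 (- (p * x)).
  set e := expR _ => e0 e1; split.
    by rewrite subr_ge0 exprn_ile1 ?subr_ge0// gerBl.
  by rewrite gerBl exprn_ge0// subr_ge0.
- move=> x x0 xs; rewrite lerD2l lerN2.
  have e1 := expp x x0; have e0 := expR_ge0 (- (p * x)).
  have Ne : eps^-1 <= N%:R * expR (- (p * x)).
    apply: (@le_trans _ _ (y * expR (- (p * s)))).
      by rewrite /y mulrAC -expRD subrr expR0 mul1r.
    by rewrite ler_pM ?expR_ge0 ?(ltW yN)// ler_expR lerN2 ler_wpM2l.
  (* With [z = e ^ (- p x)]: [(1 - z) ^ N <= e ^ (- N z) <= 1 / (1 + N z) <= eps]. *)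
  apply: (@le_trans _ _ (expR (- expR (- (p * x))) ^+ N)).
    by rewrite lerXn2r ?nnegrE ?subr_ge0 ?expR_ge0//; exact: expR_ge1Dx.
  rewrite -expRM_natl mulrN expRN -[leRHS]invrK lef_pV2 ?posrE ?invr_gt0 ?expR_gt0//.
  by apply: (le_trans Ne); apply: le_trans (expR_ge1Dx _); rewrite lerDr.
- move=> x s'x; have x0 : 0 <= x by rewrite (le_trans _ s'x)// ltW// (le_lt_trans s0).
  apply: le_trans (one_subrX_le _ (expR_ge0 _) (expp x x0)) _.
  have NE : N%:R <= (eps^-1 + 1) * expR (p * s).
    rewrite /N -natr1 mulrDl mul1r lerD//; first by rewrite mulrC.
    by rewrite -[leLHS]expR0 ler_expR mulr_ge0.
  apply: le_trans (ler_wpM2r (expR_ge0 _) NE) _.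
  rewrite -mulrA -expRD.
  (* Here [p s - p x = - p (s' - s) - p (x - s')], and [p >= q] is used in the last term. *)
  apply: (@le_trans _ _ ((eps^-1 + 1) * (expR (q * s') * expR (- (p * (s' - s))) * expR (- (q * x))))).
    rewrite ler_wpM2l// -!expRD ler_expR.
    have : 0 <= (p - q) * (x - s').
      by rewrite mulr_ge0 ?subr_ge0.
    by lra.
  rewrite !mulrA ler_wpM2r ?expR_ge0// expRN ler_pdivrMr ?expR_gt0//.
  rewrite [leRHS]mulrC -ler_pdivrMr// -/B.
  apply: (@le_trans _ _ (p * (s' - s))); last first.
    by apply: le_trans (expR_ge1Dx _); rewrite lerDr.
  by rewrite /p mulrDl divfK ?gt_eqF// lerDl mulr_ge0// ltW.
Qed.

Lemma Rintegral_cst_segment (R : realType) (c U : R) : 0 <= U ->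
  \int[lebesgue_measure]_(u in `[0, U]) c = c * U.
Proof.
move=> U0; have muU : lebesgue_measure (`[0%R, U] : set R) = U%:E.
  rewrite lebesgue_measure_itv/= lte_fin; case: ltP => [_|U0']; first by rewrite sube0.
  by congr EFin; apply/eqP; rewrite eq_le U0 U0'.
by rewrite /Rintegral integral_cst//= muU.
Qed.

(** The integral for [f] is at least [(1 - eps) b], from [[0, b]] alone; that for [g] is at most
    [a + eps M], the part past [a] costing [eps M]. As [p] and [N] are fixed before [f] and [g], one
    test function serves a whole sequence. *)
Lemma cutoff_gap (R : realType) (q s s' a b M : R) :
  0 <= q -> 0 <= s -> s < s' -> 0 <= a -> a < b -> 0 <= M ->
  exists p N, let phi x : R := 1 - (1 - expR (- (p * x))) ^+ N in q <= p /\
    forall f g : R -> R, nondecreasing_fun f -> nondecreasing_fun g ->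
      (forall u, 0 <= f u) -> (forall u, 0 <= g u) ->
      lebesgue_measure.-integrable `[0, +oo[ (EFin \o (fun u => phi (f u))) ->
      lebesgue_measure.-integrable `[0, +oo[ (EFin \o (fun u => phi (g u))) ->
      f b <= s -> s' <= g a -> (log_laplace g q <= M%:E)%E ->
      \int[lebesgue_measure]_(u in `[0, +oo[) phi (g u) + (b - a) / 2 <=
      \int[lebesgue_measure]_(u in `[0, +oo[) phi (f u).
Proof.
move=> q0 s0 ss' a0 ab M0; have b0 : 0 < b by rewrite (le_lt_trans a0).
have bM : 0 < b + M by rewrite ltr_wpDr.
(* The losses [eps b] and [eps M] together consume half of [b - a]. *)
pose eps := (b - a) / 2 / (b + M).
have eps0 : 0 < eps by rewrite !divr_gt0// subr_gt0.
have epsE : eps * (b + M) = (b - a) / 2 by rewrite divfK// gt_eqF.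
have [p [N /=]] := exists_cutoff q0 s0 ss' eps0.
set phi := fun x : R => 1 - (1 - expR (- (p * x))) ^+ N.
move=> [qp phi01 phi_s phi_s']; exists p, N; split=> //.
move=> f g f_nd g_nd f0 g0 fi gi fb ga gM.
have isub (h : R -> R) (D : set (measurableTypeR R)) : measurable D -> D `<=` `[0, +oo[%classic ->
    lebesgue_measure.-integrable `[0, +oo[ (EFin \o h) ->
    lebesgue_measure.-integrable D (EFin \o h).
  by move=> mD D0; exact: integrableS.
have sub1 U : `[0, U]%classic `<=` (`[0, +oo[%classic : set R) by exact: subset_itvl.
have sub2 U : 0 <= U -> `]U, +oo[%classic `<=` (`[0, +oo[%classic : set R).
  by move=> U0 u /=; rewrite !in_itv/= !andbT => /ltW; exact: le_trans.
have lower : (1 - eps) * b <= \int[lebesgue_measure]_(u in `[0, +oo[) phi (f u).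
  rewrite -(Rintegral_cst_segment _ (ltW b0)).
  apply: (@le_trans _ _ (\int[lebesgue_measure]_(u in `[0, b]) phi (f u))).
    apply: le_Rintegral => //; first exact: integrable_cst_segment.
      exact: isub fi.
    move=> u /=; rewrite in_itv/= => /andP[u0 ub]; apply: phi_s => //.
    by apply: le_trans fb; exact: f_nd.
  rewrite -subr_ge0 (Rintegral_itvB fi)//; last by rewrite bnd_simp ltW.
  by apply: Rintegral_ge0 => u _; exact: (phi01 _ _).1.
have upper : \int[lebesgue_measure]_(u in `[0, +oo[) phi (g u) <= a + eps * M.
  rewrite -(subrK (\int[lebesgue_measure]_(u in `[0, a]) phi (g u)) (\int[_]_(u in _) _)).
  rewrite (Rintegral_itvB gi)// addrC lerD//.
    rewrite -[leRHS]mul1r -(Rintegral_cst_segment _ a0).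
    apply: le_Rintegral => //; [exact: isub gi|exact: integrable_cst_segment|].
    by move=> u _; exact: (phi01 _ _).2.
  have gq := integrable_expR_neg g_nd gM.
  have gqa : lebesgue_measure.-integrable `]a, +oo[ (EFin \o (fun u => expR (- (q * g u)))).
    by apply: isub gq => //; exact: sub2.
  apply: (@le_trans _ _ (\int[lebesgue_measure]_(u in `]a, +oo[) (eps * expR (- (q * g u))))).
    apply: le_Rintegral => //.
    - by apply: isub gi => //; exact: sub2.
    - by move: gqa => /(@integrableZl _ _ _ _ _ _ eps); exact.
    - move=> u /=; rewrite in_itv/= andbT => au; apply: phi_s'.
      by apply: (le_trans ga); apply: g_nd; exact: ltW.
  rewrite RintegralZl// ler_wpM2l ?(ltW eps0)// -lee_fin fineK; last first.
    exact: integrable_fin_num.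
  apply: le_trans gM; apply: ge0_subset_integral => //; last exact: sub2.
  by apply/measurable_EFinP; exact: measurable_expR_neg.
apply: le_trans lower; rewrite -lerBrDr; apply: (le_trans upper).
by clearbody eps; clear -epsE; lra.
Qed.

(** * From convergence of transforms to convergence of histories *)

Lemma log_laplace_cvg_pointwise (R : realType) (c : R) (ks : nat -> R -> R) (k : R -> R) :
  0 <= c -> (forall n, nondecreasing_fun (ks n)) -> (forall n u, 0 <= ks n u) ->
  nondecreasing_fun k -> (forall u, 0 < k u) ->
  (forall q, c < q -> exists M, forall n, (log_laplace (ks n) q <= M%:E)%E) ->
  (forall q, c < q -> log_laplace (ks n) q @[n --> \oo] --> log_laplace k q) ->
  forall u, 0 < u -> {for u, continuous k} -> ks n u @[n --> \oo] --> k u.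
Proof.
move=> c0 ks_nd ks0 k_nd k0 ksM ksk u u0 cu.
have q0 : 0 <= c + 1 by rewrite addr_ge0.
have [M Mc] : exists M, forall n, (log_laplace (ks n) (c + 1) <= M%:E)%E.
  by apply: ksM; rewrite ltrDl.
have kM : (log_laplace k (c + 1) <= M%:E)%E.
  by apply: (cvge_to_le (ksk _ _)); [rewrite ltrDl|exact: nearW].
have M0 : 0 <= M by rewrite -lee_fin; apply: le_trans kM; exact: integral_ge0.
have kge0 v : 0 <= k v by exact: ltW.
(* All the exponents [(i + 1) p] exceed [c], since [p >= c + 1 > 0]. *)
have cutoff_cvg p N : c + 1 <= p ->
    integrals_converge ks k (fun x => 1 - (1 - expR (- (p * x))) ^+ N).
  move=> cp; apply: integrals_converge_cutoff => i.
  have ci : c < i.+1%:R * p.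
    apply: (@lt_le_trans _ _ p); first by lra.
    by rewrite ler_peMl ?ler1n//; lra.
  by apply: integrals_converge_expR => //; [exact: ksM|exact: ksk].
apply/cvgrPdist_lt => e e0; have e20 : 0 < e / 2 by rewrite divr_gt0.
have cu_dist eps : 0 < eps -> exists2 r, 0 < r & forall x, `|u - x| < r -> `|k u - k x| < eps.
  by move/cvgrPdist_lt : cu => /[apply] -[r /= r0 kr]; exists r.
(* If [ks n u <= s], then [ks n] is at most [s] on [[0, u]], while by continuity [k] is at least
   [s'] from some [a < u] on; the integrals would differ by [(u - a) / 2], against their
   convergence. *)
have near_lower : \forall n \near \oo, k u - e < ks n u.
  (* The level of a cutoff must be nonnegative; [s < k u] survives the maximum because [k u > 0]. *)
  pose s := Num.max 0 (k u - e).
  have su : s < k u by rewrite gt_max k0 ltrBlDr ltrDl.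
  have s0 : 0 <= s by rewrite le_max lexx.
  pose s' := (s + k u) / 2; have ss' : s < s' by rewrite midf_lt.
  have s'u : s' < k u by rewrite midf_lt.
  have [a [a0 au s'a]] : exists a, [/\ 0 <= a, a < u & s' <= k a].
    have /cu_dist[r r0 kr] : 0 < k u - s' by rewrite subr_gt0.
    have rmax : `|u - Num.max 0 (u - r / 2)| < r.
      rewrite ger0_norm ?subr_ge0 ?ge_max ?(ltW u0) ?gerBl ?divr_ge0 ?(ltW r0)//.
      by rewrite ltrBlDr -ltrBlDl lt_max; apply/orP; right; lra.
    exists (Num.max 0 (u - r / 2)); split; first by rewrite le_max lexx.
      by rewrite gt_max u0 gtrBl divr_gt0.
    by move: (kr _ rmax); rewrite ltr_norml => /andP[_]; lra.
  have [p [N /= [cp gap]]] := cutoff_gap q0 s0 ss' a0 au M0.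
  have [phin phik /cvgrPdist_lt/(_ ((u - a) / 2))] := cutoff_cvg p N cp.
  rewrite divr_gt0 ?subr_gt0// => /(_ isT); apply: filterS => n phi_cvg.
  have [uks|] := ltP s (ks n u); first by rewrite (le_lt_trans _ uks)// le_max lexx orbT.
  move=> ksu; have := gap _ _ (ks_nd n) k_nd (ks0 n) kge0 (phin n) phik ksu s'a kM.
  by rewrite addrC -lerBrDr => /le_trans/(_ (ler_norm _)); rewrite distrC leNgt phi_cvg.
(* The roles are exchanged: [k] is at most [k u + e / 2] up to some [b > u], while [ks n] would be
   at least [k u + e] from [u] on. The bound [M] now concerns [ks n], hence its uniformity in
   [n]. *)
have near_upper : \forall n \near \oo, ks n u < k u + e.
  have s0 : 0 <= k u + e / 2 by rewrite addr_ge0// ltW.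
  have ss' : k u + e / 2 < k u + e by lra.
  have [b [ub kb]] : exists b, u < b /\ k b <= k u + e / 2.
    have [r r0 kr] := cu_dist _ e20.
    have rb : `|u - (u + r / 2)| < r by rewrite opprD addNKr normrN gtr0_norm; lra.
    exists (u + r / 2); split; first by rewrite ltrDl divr_gt0.
    by move: (kr _ rb); rewrite ltr_norml => /andP[+ _]; lra.
  have [p [N /= [cp gap]]] := cutoff_gap q0 s0 ss' (ltW u0) ub M0.
  have [phin phik /cvgrPdist_lt/(_ ((b - u) / 2))] := cutoff_cvg p N cp.
  rewrite divr_gt0 ?subr_gt0// => /(_ isT); apply: filterS => n phi_cvg.
  have [//|] := ltP (ks n u) (k u + e).
  move=> ksu; have := gap _ _ k_nd (ks_nd n) kge0 (ks0 n) phik (phin n) kb ksu (Mc n).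
  by rewrite addrC -lerBrDr => /le_trans/(_ (ler_norm _)); rewrite leNgt phi_cvg.
near=> n; rewrite ltr_norml; apply/andP; split.
- by rewrite ltrNl opprB ltrBlDl; near: n.
- by rewrite ltrBlDr -ltrBlDl; near: n.
Unshelve. all: by end_near. Qed.

(** * Return to the original time *)

(** The map [u |-> t0 e ^ u] is a homeomorphism onto its image, and the [max] in [log_history] is
    inert near a positive [u]. *)
Lemma continuous_log_history (R : realType) (t0 u : R) (l : R -> R) :
  0 < t0 -> 0 < u ->
  {for t0 * expR u, continuous l} <-> {for u, continuous (log_history t0 l)}.
Proof.
move=> t0_gt0 u0; have kuE : log_history t0 l u = l (t0 * expR u).
  by rewrite /log_history (max_idPl (ltW u0)).
split=> [lc|kc].
- rewrite /prop_for /continuous_at kuE.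
  have lc' : l (t0 * expR v) @[v --> u] --> l (t0 * expR u).
    apply: (@cvg_comp _ _ _ (fun v => t0 * expR v) l _ (nbhs (t0 * expR u))); last exact: lc.
    by apply: cvgMl_tmp; exact: continuous_expR.
  apply: cvg_trans lc'; apply: near_eq_cvg; near=> v.
  rewrite /log_history; congr (l (_ * expR _)); apply/esym/max_idPl/ltW.
  by near: v; exact: (lt_nbhsr u0).
- have t0u : t0 < t0 * expR u by rewrite ltr_pMr// -expR0 ltr_expR.
  have uE : ln (t0 * expR u / t0) = u by rewrite mulrAC divff ?gt_eqF// mul1r expRK.
  rewrite /prop_for /continuous_at -kuE.
  have lnc : ln (t / t0) @[t --> t0 * expR u] --> u.
    rewrite -[X in _ --> X]uE.
    apply: (@cvg_comp _ _ _ (fun t => t / t0) (@ln R) _ (nbhs (t0 * expR u / t0))).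
      by apply: cvgMr_tmp; exact: cvg_id.
    by apply: continuous_ln; rewrite divr_gt0// mulr_gt0// expR_gt0.
  have kc' : log_history t0 l (ln (t / t0)) @[t --> t0 * expR u] --> log_history t0 l u.
    exact: (@cvg_comp _ _ _ (fun t => ln (t / t0)) (log_history t0 l) _ (nbhs u) _ lnc kc).
  apply: cvg_trans kc'; apply: near_eq_cvg; near=> t.
  have t0t : t0 < t by near: t; exact: (lt_nbhsr t0u).
  rewrite /log_history (max_idPl _); last by rewrite ln_ge0// ler_pdivlMr// mul1r ltW.
  have t_gt0 : 0 < t := lt_trans t0_gt0 t0t.
  by rewrite lnK ?posrE ?divr_gt0// mulrC divfK// gt_eqF.
Unshelve. all: by end_near. Qed.

Lemma log_history_cvg_pinfty (R : realType) (t0 : R) (l : R -> R) :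
  0 < t0 -> min_history t0 l -> log_history t0 l u @[u --> +oo] --> +oo.
Proof.
move=> t0_gt0 [_ _ _ ly]; apply/cvgryPge => A.
have /cvgryPge/(_ A)[V [_ lV]] := ly.
near=> u; rewrite /log_history; apply: lV.
have Vu : V / t0 < u by near: u; apply: nbhs_pinfty_gt; rewrite num_real.
rewrite mulrC -ltr_pdivrMr//; apply: (lt_le_trans Vu).
apply: (@le_trans _ _ (Num.max u 0)); first by rewrite le_max lexx.
by apply: le_trans (expR_ge1Dx _); rewrite lerDr.
Unshelve. all: by end_near. Qed.

Unset Implicit Arguments.

(** Convergence concerns [t > t0]: a jump of [ls n] just after [t0] may move into [t0] without
    affecting the limit of the transforms. *)
Theorem theorem3p4 (R : realType) (t0 c : R) (ls : nat -> R -> R) :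
  0 < t0 -> 0 <= c ->
  (forall n, min_history t0 (ls n)) ->
  (forall q, c < q -> exists M : R, forall n,
      (laplace_stieltjes (trace_of t0 (ls n)) q <= M%:E)%E) ->
  forall l : R -> R, min_history t0 l ->
    ((forall t, t0 < t -> {for t, continuous l} ->
        ls n t @[n --> \oo] --> l t)
     <->
     (forall q, c < q ->
        laplace_stieltjes (trace_of t0 (ls n)) q @[n --> \oo]
          --> laplace_stieltjes (trace_of t0 l) q)).
Proof.
move=> t0_gt0 c0 hls lsM l hl.
pose ks n := log_history t0 (ls n); pose k := log_history t0 l.
have ks_nd n : nondecreasing_fun (ks n) by exact: nondecreasing_log_history.
have k_nd : nondecreasing_fun k by exact: nondecreasing_log_history.
have ks_ge0 n u : 0 <= ks n u by rewrite ltW// log_history_gt0.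
have k_gt0 u : 0 < k u by exact: log_history_gt0.
have ksM q : c < q -> exists M, forall n, (log_laplace (ks n) q <= M%:E)%E.
  move=> /lsM [M HM]; exists M => n.
  by rewrite -(laplace_stieltjes_trace q t0_gt0 (hls n)).
have kE (f : R -> R) u : 0 < u -> f (t0 * expR u) = log_history t0 f u.
  by move=> u0; rewrite /log_history (max_idPl (ltW u0)).
split=> [lsl q cq|lsl t t0t].
  rewrite laplace_stieltjes_trace//.
  under eq_cvg do rewrite laplace_stieltjes_trace//.
  (* An exponent strictly between [c] and [q] has a uniform bound and leaves room for the tail
     estimate at [q]. *)
  have [M HM] := ksM ((c + q) / 2) (midf_lt cq).1.
  apply: (cvg_log_laplace _ _ ks_nd ks_ge0 k_nd _ _ HM).
  - by rewrite divr_ge0// addr_ge0// (le_trans c0)// ltW.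
  - exact: (midf_lt cq).2.
  - by move=> u; exact: ltW.
  - exact: log_history_cvg_pinfty.
  move=> u u0 /(continuous_log_history _ t0_gt0 u0) lc.
  rewrite /ks /k -kE//; under eq_cvg do rewrite -kE//.
  by apply: lsl lc; rewrite ltr_pMr// -expR0 ltr_expR.
have ksk := log_laplace_cvg_pointwise c0 ks_nd ks_ge0 k_nd k_gt0 ksM _.
have u0 : 0 < ln (t / t0) by rewrite ln_gt0// ltr_pdivlMr// mul1r.
have t_gt0 : 0 < t := lt_trans t0_gt0 t0t.
have -> : t = t0 * expR (ln (t / t0)).
  by rewrite lnK ?posrE ?divr_gt0// mulrC divfK// gt_eqF.
move=> /(continuous_log_history _ t0_gt0 u0) kc.
rewrite kE//; under eq_cvg do rewrite kE//.
apply: ksk => // q cq.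
rewrite -laplace_stieltjes_trace//; under eq_cvg do rewrite -laplace_stieltjes_trace//.
exact: lsl.
Qed.
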